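(* Let $(\Omega,\|\cdot\|)$ be a separable Banach space. For each $d$, there is a free Borel action $\mathbb{R}^d\curvearrowright X$ on a standard Borel space $X$ such that for any everywhere unbounded Borel equivariant $\phi:X\to C(\mathbb{R}^d,\Omega)$ and any rate function $f$ there is a point $x\in X$ such that $$\limsup_{R\to\infty}\frac{M_{\phi,x}(R)}{f(R)}=+\infty.$$
   Context: $d\ge1$ is an integer. $C(\mathbb{R}^d,\Omega)$ is the space of continuous functions $\mathbb{R}^d\to\Omega$ with the topology of uniform convergence on compact sets, the corresponding Borel $\sigma$-algebra, and the argument shift action $(r\cdot u)(s)=u(s+r)$ of $\mathbb{R}^d$. For a Borel $\mathbb{R}^d$-equivariant map $\phi:X\to C(\mathbb{R}^d,\Omega)$ and $x\in X$, $M_{\phi,x}(R)=\max_{|r|\le R}\|\phi(x)(r)\|$ for $R>0$. The map $\phi$ is everywhere unbounded if $M_{\phi,x}(R)\to+\infty$ as $R\to+\infty$ for every $x\in X$. A rate function is a non-decreasing $f:[0,\infty)\to[0,\infty)$ with $\lim_{R\to\infty}f(R)=+\infty$. *)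

(* Defs.v *)
From HB Require Import structures.
From mathcomp Require Import all_boot all_order all_algebra.
From mathcomp Require Import all_classical all_reals all_analysis.

Set Implicit Arguments.
Unset Strict Implicit.
Unset Printing Implicit Defensive.

Import Order.TTheory GRing.Theory Num.Theory.
Import numFieldNormedType.Exports.

Local Open Scope classical_set_scope.
Local Open Scope ring_scope.

Definition separable_space (T : topologicalType) : Prop :=
  exists2 D : set T, countable D & dense D.

Definition complete_space (T : uniformType) : Prop :=
  forall F : set_system T, ProperFilter F -> cauchy F -> exists l : T, F --> l.

Definition borel (T : topologicalType) : Type := g_sigma_algebraType (@open T).

(* X is isomorphic, as a measurable space, to a complete separable metric space
   P with its Borel sigma-algebra. *)
Definition standard_borel (R : realType) (disp : measure_display)
    (X : measurableType disp) : Prop :=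
  exists (P : metricType R) (g : X -> P),
    [/\ complete_space P, separable_space P, bijective g &
        forall B : set P, measurable (g @^-1` B) <-> <<s @open P >> B].

(* The library's norm on 'rV[R]_d is the sup norm. *)
Definition euclidean_norm (R : realType) (d : nat) (r : 'rV[R]_d) : R :=
  Num.sqrt (\sum_(i < d) r ord0 i ^+ 2).

(* C(U, V), with the topology of uniform convergence on compact sets. *)
Definition cts_space (U : topologicalType) (V : uniformType) : Type :=
  initial_topology
    (fun u : continuousType U V => (u : U -> V) : {family compact, U -> V}).

HB.instance Definition _ (U : topologicalType) (V : uniformType) :=
  Topological.on (cts_space U V).

HB.instance Definition _ (U : topologicalType) (V : puniformType) :=
  isPointed.Build (cts_space U V) (mkcts (@cst_continuous U V point)).

Lemma shift_continuous (R : realType) (d : nat) (V : uniformType)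
    (r : 'rV[R]_d) (u : cts_space 'rV[R]_d V) :
  continuous (fun s : 'rV[R]_d => u (s + r)).
Proof.
move=> s.
have shift_cvg : (s' + r) @[s' --> s] --> s + r.
  apply: (@cvgD _ _ _ _ (nbhs_filter s)); [exact: cvg_id | exact: cvg_cst].
exact: (cvg_comp _ _ shift_cvg (@cts_fun _ _ (u : continuousType _ _) (s + r))).
Qed.

(* (r . u)(s) = u (s + r) *)
Definition shift_act (R : realType) (d : nat) (V : uniformType) (r : 'rV[R]_d)
    (u : cts_space 'rV[R]_d V) : cts_space 'rV[R]_d V :=
  mkcts (@shift_continuous R d V r u).

Definition is_action (R : realType) (d : nat) (X : Type)
    (act : 'rV[R]_d -> X -> X) : Prop :=
  (forall x, act 0 x = x) /\
  (forall r s x, act (r + s) x = act r (act s x)).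

Definition borel_action (R : realType) (d : nat) (disp : measure_display)
    (X : measurableType disp) (act : 'rV[R]_d -> X -> X) : Prop :=
  is_action act /\
  measurable_fun setT
    (fun p : (borel 'rV[R]_d * X)%type => act (p.1 : 'rV[R]_d) p.2).

Definition free_action (R : realType) (d : nat) (X : Type)
    (act : 'rV[R]_d -> X -> X) : Prop :=
  forall r x, act r x = x -> r = 0.

Definition borel_equivariant (R : realType) (d : nat)
    (Omega : completeNormedModType R) (disp : measure_display)
    (X : measurableType disp) (act : 'rV[R]_d -> X -> X)
    (phi : X -> cts_space 'rV[R]_d Omega) : Prop :=
  measurable_fun setT (phi : X -> borel (cts_space 'rV[R]_d Omega)) /\
  (forall r x, phi (act r x) = shift_act r (phi x)).

(* The supremum is attained when 0 <= t, since closed balls of R^d are compact. *)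
Definition max_on_ball (R : realType) (d : nat) (Omega : normedModType R)
    (u : cts_space 'rV[R]_d Omega) (t : R) : R :=
  sup [set `|u r| | r in [set r : 'rV[R]_d | euclidean_norm r <= t]].

Definition everywhere_unbounded (R : realType) (d : nat)
    (Omega : normedModType R) (X : Type)
    (phi : X -> cts_space 'rV[R]_d Omega) : Prop :=
  forall x, max_on_ball (phi x) t @[t --> +oo] --> +oo.

(* A function on [0, +oo) is given by a function on R whose values at negative
   arguments are irrelevant. *)
Definition rate_function (R : realType) (f : R -> R) : Prop :=
  [/\ forall t, 0 <= t -> 0 <= f t,
      forall s t, 0 <= s -> s <= t -> f s <= f t &
      f t @[t --> +oo] --> +oo].

(* Main.v *)
Require Import Defs.
From HB Require Import structures.
From mathcomp Require Import all_boot all_order all_algebra.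
From mathcomp Require Import all_classical all_reals all_analysis.
From mathcomp Require Import lra zify.

Set Implicit Arguments.
Unset Strict Implicit.
Unset Printing Implicit Defensive.

Import Order.TTheory GRing.Theory Num.Theory.
Import numFieldNormedType.Exports.

Local Open Scope classical_set_scope.
Local Open Scope ring_scope.

(** The action is a linear flow on the torus of dimension [2 d]: the coordinate
    [r_i] translates the [i]-th factor [(R/Z)^2] by [(r_i, pi r_i)]. Since [pi]
    is irrational the flow is free, and it is uniformly recurrent: for every
    nonempty open set [U] there is a [K] such that every point enters [U] after
    a time of norm at most [K] ([torus_flow_hits]).

    Uniform recurrence forbids slow growth. Suppose that the growth of [phi x]
    is bounded by a multiple of [f] for every [x]. The points [x] with
    [`|phi x r| <= N f(m)] for all [m > N] and all [r] in the ball of radius [m]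
    form a Borel set, and these sets cover the torus as [N] varies. By Baire's
    theorem one of them is comeager in a nonempty open set [U]
    ([baire_cover]). Take the bound [K] for this [U], and a fixed [m > N] with
    the ball of radius [K] inside the ball of radius [m]. Along a generic orbit,
    every point of a dense set of times is carried into the good part of [U] by
    a time [q] of norm at most [K]; undoing this time stays in the ball of
    radius [m], so the norm of the value there is at most [N f(m)]. By
    continuity [phi x] is bounded on all of R^d for such an [x]
    ([torus_flow_fast_growth]).

    The category argument takes place on R^(2 d), a Banach space that covers
    the torus by a continuous map; sets are pulled back along this map, and a
    generic point avoids all integer translates of the exceptional set. *)

(** * Comeager sets and the Baire property *)

Definition comeager (T : topologicalType) (A : set T) : Prop :=
  exists2 F : (set T)^nat, (forall i, open (F i) /\ dense (F i)) &
    \bigcap_i F i `<=` A.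

Lemma comeagerS (T : topologicalType) (A B : set T) :
  A `<=` B -> comeager A -> comeager B.
Proof. by move=> AB [F oF FA]; exists F => //; exact: subset_trans AB. Qed.

Lemma comeager_open_dense (T : topologicalType) (A : set T) :
  open A -> dense A -> comeager A.
Proof. by move=> oA dA; exists (fun=> A) => [//|x Ax]; exact: (Ax 0%N). Qed.

Lemma comeager_bigcap (J : countType) (T : topologicalType) (A : J -> set T) :
  (forall i, comeager (A i)) -> comeager (\bigcap_i A i).
Proof.
move=> cA.
have /choice[F FA] : forall i : J, exists F : (set T)^nat,
    (forall j, open (F j) /\ dense (F j)) /\ \bigcap_j F j `<=` A i.
  by move=> i; have [F ? ?] := cA i; exists F.
(* The countable family of countable families is listed by unpickling. *)
exists (fun n => if unpickle n is Some (i, j) then F i j else setT).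
  move=> n; case: (unpickle n) => [[i j]|]; first exact: (FA i).1.
  split; first exact: openT.
  by move=> O O0 _; rewrite setIT.
move=> x Fx i _; apply: (FA i).2 => j _.
by have := Fx (pickle (i, j)) I; rewrite /= pickleK.
Qed.

Lemma comeagerI (T : topologicalType) (A B : set T) :
  comeager A -> comeager B -> comeager (A `&` B).
Proof.
move=> cA cB.
apply: (@comeagerS _ (\bigcap_b (if b then A else B))).
  by move=> x ABx; split; [exact: (ABx true I)|exact: (ABx false I)].
by apply: comeager_bigcap => -[].
Qed.

Lemma comeager_nonempty (K : realType) (V : completeNormedModType K)
    (A : set V) : comeager A -> A !=set0.
Proof.
move=> [F oF FA].
have [|x [_ Fx]] := Baire oF _ openT; first by exists 0.
by exists x; exact: FA.
Qed.

Lemma comeager_translate (K : realType) (V : normedModType K) (a : V)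
    (A : set V) : comeager A -> comeager [set v | A (v + a)].
Proof.
have ctsD (b : V) : continuous (fun v : V => v + b).
  by move=> v; apply: cvgD; [exact: cvg_id|exact: cvg_cst].
move=> [F oF FA]; exists (fun n => [set v | F n (v + a)]); last first.
  by move=> v Fv; apply: FA => n _; exact: Fv.
move=> n; have [oFn dFn] := oF n; split.
  exact: (open_comp (fun v _ => ctsD a v) oFn).
move=> O [v Ov] oO.
have [||w [Ow Fw]] := dFn [set w | O (w - a)].
- by exists (v + a); rewrite /= addrK.
- exact: (open_comp (fun v _ => ctsD (- a) v) oO).
by exists (w - a); split => //=; rewrite subrK.
Qed.

Definition baire_property (T : topologicalType) (A : set T) : Prop :=
  exists2 U, open U & comeager [set x | A x <-> U x].

Lemma baire_property_open (T : topologicalType) (A : set T) :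
  open A -> baire_property A.
Proof.
move=> oA; exists A => //.
apply: comeagerS (comeager_open_dense openT _) => // O O0 _.
by rewrite setIT.
Qed.

(** The exterior of an open set, together with the set, is open and dense; on
    it the complement of the open set is again open. *)
Lemma baire_propertyC (T : topologicalType) (A : set T) :
  baire_property A -> baire_property (~` A).
Proof.
move=> [U oU cU]; exists (~` U)°; first exact: open_interior.
have cUE : comeager (U `|` (~` U)°).
  apply: comeager_open_dense; first by apply: openU => //; exact: open_interior.
  move=> O [x Ox] oO.
  have [OU|/nonsubset[y [Oy /contrapT Uy]]] := pselect (O `<=` ~` U).
    by exists x; split => //; right; rewrite /interior/= nbhsE; exists O.
  by exists y; split => //; left.
apply: comeagerS (comeagerI cU cUE) => x /= [AU UE].
by split => [nA|/interior_subset nU /AU //]; case: UE => // /AU.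
Qed.

Lemma baire_property_bigcup (T : topologicalType) (A : (set T)^nat) :
  (forall n, baire_property (A n)) -> baire_property (\bigcup_n A n).
Proof.
move=> bA.
have /choice[U AU] : forall n, exists U,
    open U /\ comeager [set x | A n x <-> U x].
  by move=> n; have [U ? ?] := bA n; exists U.
exists (\bigcup_n U n); first by apply: bigcup_open => n _; exact: (AU n).1.
apply: comeagerS (comeager_bigcap (fun n => (AU n).2)) => x AUx.
by split=> -[n _ ?]; exists n => //; apply/(AUx n I).
Qed.

Lemma baire_property_preimage (T U : topologicalType) (f : T -> U) (B : set U) :
  continuous f -> <<s @open U >> B -> baire_property (f @^-1` B).
Proof.
move=> cf; suff : <<s @open U >> `<=` [set B | baire_property (f @^-1` B)].
  exact.
apply: smallest_sub.
  split => /= [|A bA|A bA].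
  - by rewrite preimage_set0; apply: baire_property_open; exact: open0.
  - by rewrite setTD preimage_setC; exact: baire_propertyC.
  - by rewrite preimage_bigcup; exact: baire_property_bigcup.
move=> A oA /=; apply: baire_property_open.
by move/continuousP : cf; apply.
Qed.

(** Each set is open up to an exceptional meager set. A point that avoids all
    the exceptional sets lies in some [E n], hence in the corresponding open
    set, which is therefore not empty. *)
Lemma baire_cover (K : realType) (V : completeNormedModType K)
    (E : (set V)^nat) :
  (forall n, baire_property (E n)) -> \bigcup_n E n = setT ->
  exists n U, [/\ open U, U !=set0 & comeager [set v | U v -> E n v]].
Proof.
move=> bE Ecover.
have /choice[U EU] : forall n, exists U,
    open U /\ comeager [set v | E n v <-> U v].
  by move=> n; have [U ? ?] := bE n; exists U.
have [v EUv] := comeager_nonempty (comeager_bigcap (fun n => (EU n).2)).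
have [n _ Env] : (\bigcup_n E n) v by rewrite Ecover.
exists n, (U n); split; first exact: (EU n).1.
  by exists v; apply/(EUv n I).
by apply: comeagerS (EU n).2 => w /= ->.
Qed.

(** * The torus *)

Definition nearest_int (R : realType) (x : R) : R := (Num.floor (x + 2^-1))%:~R.

Lemma nearest_int_le (R : realType) (x k : R) :
  k \is a Num.int -> `|x - nearest_int x| <= `|x - k|.
Proof.
move=> kint; have [->//|kx] := eqVneq k (nearest_int x).
have xk : 1 <= `|k - nearest_int x|.
  by apply: norm_intr_ge1; rewrite ?subr_eq0// rpredB// intr_int.
have x2 : `|x - nearest_int x| <= 2^-1.
  have /andP[] := floor_itv (x + 2^-1).
  rewrite intrD -/(nearest_int x) => h1 h2.
  by rewrite ler_norml; lra.
have : `|k - nearest_int x| <= `|x - k| + `|x - nearest_int x|.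
  by rewrite (distrC x k) (le_trans _ (ler_normD _ _))// addrA subrK.
lra.
Qed.

Definition int_vec (R : realType) n (v : 'rV[R]_n) : Prop :=
  forall i, v ord0 i \is a Num.int.

Lemma int_vec0 (R : realType) n : int_vec (0 : 'rV[R]_n).
Proof. by move=> i; rewrite mxE rpred0. Qed.

Lemma int_vecD (R : realType) n (v w : 'rV[R]_n) :
  int_vec v -> int_vec w -> int_vec (v + w).
Proof. by move=> vint wint i; rewrite mxE rpredD. Qed.

Lemma int_vecN (R : realType) n (v : 'rV[R]_n) : int_vec v -> int_vec (- v).
Proof. by move=> vint i; rewrite mxE rpredN. Qed.

Lemma int_vecB (R : realType) n (v w : 'rV[R]_n) :
  int_vec v -> int_vec w -> int_vec (v - w).
Proof. by move=> vint wint; apply: int_vecD => //; exact: int_vecN. Qed.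

(** Distance to the integer lattice, for the sup norm. *)
Definition torus_norm (R : realType) n (v : 'rV[R]_n) : R :=
  `|v - map_mx (@nearest_int R) v|.

Lemma mx_norm_le (R : realType) m n (A : 'M[R]_(m, n)) (c : R) : 0 <= c ->
  (`|A| <= c) <-> (forall i j, `|A i j| <= c).
Proof.
move=> c0; rewrite /Num.norm/= mx_normrE; split=> [/bigmax_leP[_ Ac] i j|Ac].
  exact: (Ac (i, j)).
by apply/bigmax_leP; split => // -[i j] _; exact: Ac.
Qed.

Lemma mx_norm_entry (R : realType) m n (A : 'M[R]_(m, n)) i j :
  `|A i j| <= `|A|.
Proof. by have /mx_norm_le := lexx `|A|; apply. Qed.

Lemma int_vec_nearest_int (R : realType) n (v : 'rV[R]_n) :
  int_vec (map_mx (@nearest_int R) v).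
Proof. by move=> i; rewrite mxE /nearest_int intr_int. Qed.

Lemma torus_norm_le (R : realType) n (v z : 'rV[R]_n) :
  int_vec z -> torus_norm v <= `|v - z|.
Proof.
move=> zint; apply/mx_norm_le => // i j; rewrite (ord1 i) !mxE.
apply: (le_trans (nearest_int_le _ (zint j))).
by have := mx_norm_entry (v - z) ord0 j; rewrite !mxE.
Qed.

Lemma torus_norm_le_norm (R : realType) n (v : 'rV[R]_n) : torus_norm v <= `|v|.
Proof.
by rewrite -[v in `|v|]subr0; apply: torus_norm_le; exact: int_vec0.
Qed.

Lemma torus_norm_period (R : realType) n (v z : 'rV[R]_n) :
  int_vec z -> torus_norm (v + z) = torus_norm v.
Proof.
have le w y : int_vec y -> torus_norm (w + y) <= torus_norm w.
  move=> yint; rewrite [leRHS]/torus_norm -[w in leRHS](addrK y) -addrA -opprD.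
  by apply: torus_norm_le; apply: int_vecD => //; exact: int_vec_nearest_int.
move=> zint; apply/eqP; rewrite eq_le le//= -[v in leLHS](addrK z).
by apply: le; exact: int_vecN.
Qed.

Lemma torus_normN (R : realType) n (v : 'rV[R]_n) :
  torus_norm (- v) = torus_norm v.
Proof.
have le w : torus_norm (- w) <= torus_norm w :> R.
  rewrite [leRHS]/torus_norm -normrN opprB addrC -[X in X + _]opprK opprK.
  rewrite addrC -[map_mx _ _]opprK addrC; apply: torus_norm_le.
  by apply: int_vecN; exact: int_vec_nearest_int.
by apply/eqP; rewrite eq_le le -{1}[v]opprK le.
Qed.

Lemma torus_normD (R : realType) n (v w : 'rV[R]_n) :
  torus_norm (v + w) <= torus_norm v + torus_norm w.
Proof.
apply: (le_trans _ (ler_normD _ _)); rewrite addrACA -opprD.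
by apply: torus_norm_le; apply: int_vecD; exact: int_vec_nearest_int.
Qed.

Lemma torus_norm0 (R : realType) n (v : 'rV[R]_n) :
  torus_norm v = 0 -> int_vec v.
Proof.
move=> /normr0_eq0/eqP; rewrite subr_eq0 => /eqP ->.
exact: int_vec_nearest_int.
Qed.

Definition frac_part (R : realType) (x : R) : R := x - (Num.floor x)%:~R.

(** The torus, represented by the half-open unit cube; its topology comes from
    the quotient metric below and not from the cube. *)
Definition torus (R : realType) (n : nat) : Type :=
  {v : 'rV[R]_n | map_mx (@frac_part R) v == v}.

Lemma frac_part_idem (R : realType) n (v : 'rV[R]_n) :
  map_mx (@frac_part R) (map_mx (@frac_part R) v) == map_mx (@frac_part R) v.
Proof.
apply/eqP/rowP => i; rewrite !mxE /frac_part -[RHS]subr0; congr (_ - _).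
by rewrite floorDrz ?rpredN ?intr_int// -intrN intrKfloor subrr.
Qed.

Definition torus_proj (R : realType) n (v : 'rV[R]_n) : torus R n :=
  exist _ (map_mx (@frac_part R) v) (frac_part_idem v).

Definition torus_repr (R : realType) n (x : torus R n) : 'rV[R]_n := val x.

Lemma torus_projK (R : realType) n (x : torus R n) :
  torus_proj (torus_repr x) = x.
Proof. by apply: val_inj; apply/eqP; exact: (valP x). Qed.

(** The projection identifies exactly the vectors that differ by an integer
    vector, so the torus is the quotient by the integer lattice. *)
Lemma torus_projP (R : realType) n (v w : 'rV[R]_n) :
  torus_proj v = torus_proj w <-> int_vec (v - w).
Proof.
split=> [[/rowP vw] j|vw].
  have := vw j; rewrite !mxE /frac_part => vwj.
  have -> : v ord0 j - w ord0 j =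
      (Num.floor (v ord0 j))%:~R - (Num.floor (w ord0 j))%:~R by lra.
  by rewrite rpredB// intr_int.
apply: val_inj; apply/rowP => j; rewrite !mxE /frac_part.
have := vw j; rewrite !mxE => vwj.
rewrite -[v ord0 j](subrK (w ord0 j)) floorDzr// intrD.
move: vwj; rewrite intrEfloor => /eqP ->; lra.
Qed.

Lemma torus_reprK (R : realType) n (v : 'rV[R]_n) :
  int_vec (torus_repr (torus_proj v) - v).
Proof. by apply/torus_projP; rewrite torus_projK. Qed.

Definition torus_dist (R : realType) n (x y : torus R n) : R :=
  torus_norm (torus_repr x - torus_repr y).

Lemma torus_dist_proj (R : realType) n (v w : 'rV[R]_n) :
  torus_dist (torus_proj v) (torus_proj w) = torus_norm (v - w).
Proof.
rewrite /torus_dist -[RHS](torus_norm_period _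
  (int_vecB (torus_reprK v) (torus_reprK w))).
by congr torus_norm; apply/rowP => i; rewrite !mxE; lra.
Qed.

Section torus_metric.
Variables (R : realType) (n : nat).
Implicit Types x y z : torus R n.

Let torus_distxx x : torus_dist x x = 0.
Proof.
rewrite /torus_dist subrr; apply/eqP; rewrite eq_le normr_ge0 andbT.
by rewrite (le_trans (torus_norm_le_norm _))// normr0.
Qed.

Let torus_dist_positivity x y : torus_dist x y = 0 -> x = y.
Proof.
by move=> /torus_norm0/torus_projP; rewrite !torus_projK.
Qed.

Let torus_dist_sym x y : torus_dist x y = torus_dist y x.
Proof. by rewrite /torus_dist -torus_normN opprB. Qed.

Let torus_dist_triangle y x z :
  torus_dist x z <= torus_dist x y + torus_dist y z.
Proof.
by rewrite /torus_dist (le_trans _ (torus_normD _ _))// addrA subrK.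
Qed.

HB.instance Definition _ := Choice.on (torus R n).
HB.instance Definition _ := isPointed.Build (torus R n) (torus_proj 0).
HB.instance Definition _ := isMetric.Build R (torus R n) torus_distxx
  torus_dist_positivity torus_dist_sym torus_dist_triangle.

End torus_metric.

Lemma torus_ball (R : realType) n (x : torus R n) e :
  ball x e = [set y | torus_dist x y < e].
Proof. by rewrite ballEmdist. Qed.

Lemma torus_proj_continuous (R : realType) n :
  continuous (@torus_proj R n).
Proof.
move=> v A /nbhs_ballP[e /= e0 eA]; apply/nbhs_ballP; exists e => //= w vw.
apply: eA; rewrite torus_ball /= torus_dist_proj.
rewrite (le_lt_trans (torus_norm_le_norm _))//.
by move: vw; rewrite -ball_normE.
Qed.

Lemma torus_compact (R : realType) n : compact [set: torus R n].
Proof.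
pose I : set 'rV[R]_n := [set v | forall i, `[0, 1]%classic (v ord0 i)].
have -> : [set: torus R n] = @torus_proj R n @` I.
  apply/seteqP; split => // x _; exists (torus_repr x); last exact: torus_projK.
  move=> i /=; rewrite in_itv/=; have /eqP/rowP/(_ i) := valP x.
  rewrite mxE /frac_part => xi.
  have /andP[] := floor_itv (torus_repr x ord0 i); rewrite intrD.
  by rewrite -/(torus_repr x) in xi; lra.
apply: continuous_compact.
  by apply: continuous_subspaceT; exact: torus_proj_continuous.
exact: (@rV_compact R n (fun=> `[0, 1]%classic) (fun=> @segment_compact R 0 1)).
Qed.

Lemma torus_complete (R : realType) n : complete_space (torus R n).
Proof.
move=> F PF cF.
by apply/cvg_ex; apply: (compact_cauchy_cvg PF cF) (@torus_compact R n);
  exact: filterT.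
Qed.

Lemma dense_rV_rat (R : realType) n :
  dense (range (fun q : 'rV[rat]_n => map_mx (@ratr R) q)).
Proof.
move=> O [v Ov] oO.
have /nbhs_ballP[e /= e0 veO] : nbhs v O by exact: open_nbhs_nbhs.
have /choice[q vq] : forall i, exists q : rat, ball (v ord0 i) e (ratr q).
  move=> i; have [||x [vx [q _ qx]]] := @dense_rat R (ball (v ord0 i) e).
  - by exists (v ord0 i); exact: ballxx.
  - exact: ball_open.
  - by exists q; rewrite qx.
exists (map_mx ratr (\row_i q i)); split; last by exists (\row_i q i).
apply: veO; split => // i j; rewrite (ord1 i) !mxE; exact: vq.
Qed.

Lemma separable_rV (R : realType) n : separable_space 'rV[R]_n.
Proof.
exists (range (fun q : 'rV[rat]_n => map_mx (@ratr R) q)).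
  exact: sub_countable (card_image_le _ _) (countableP _).
exact: dense_rV_rat.
Qed.

Lemma separable_torus (R : realType) n : separable_space (torus R n).
Proof.
have [D cD dD] := separable_rV R n.
exists (@torus_proj R n @` D).
  exact: sub_countable (card_image_le _ _) cD.
move=> O [x Ox] oO; have [||v [Ov Dv]] := dD (@torus_proj R n @^-1` O).
- by exists (torus_repr x); rewrite /= torus_projK.
- by move/continuousP : (@torus_proj_continuous R n); apply.
by exists (torus_proj v); split => //; exists v.
Qed.

Lemma standard_borel_torus (R : realType) n :
  standard_borel R (borel (torus R n)).
Proof.
exists (torus R n), id; split => //.
- exact: torus_complete.
- exact: separable_torus.
- by exists id.
Qed.

(** * The flow on the torus *)

(** The rectangles are centered at points of the dense sets and have sizes
    [2 / (n + 1)]. This is why Borel sets of a product of separable spaces are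
    generated by products of Borel sets. *)
Lemma open_bigcup_rect (R : realType) (T1 T2 : pseudoMetricType R)
    (J1 J2 : countType) (p1 : J1 -> T1) (p2 : J2 -> T2) (W : set (T1 * T2)) :
  dense (range p1) -> dense (range p2) -> open W ->
  exists (A : nat -> set T1) (B : nat -> set T2),
    (forall n, open (A n) /\ open (B n)) /\ W = \bigcup_n (A n `*` B n).
Proof.
move=> dp1 dp2 oW.
have approx (T : pseudoMetricType R) (J : countType) (p : J -> T) (x : T) e :
    dense (range p) -> 0 < e -> exists j, ball x e (p j).
  move=> dp e0; have [||y [+ [j _ jy]]] := dp (ball x e)°.
  - by exists x; exact: nbhsx_ballx.
  - exact: open_interior.
  - by rewrite -jy => /interior_subset; exists j.
pose A (k : J1 * J2 * nat) := (ball (p1 k.1.1) (2 * k.2.+1%:R^-1))°.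
pose B (k : J1 * J2 * nat) := (ball (p2 k.1.2) (2 * k.2.+1%:R^-1))°.
pose code n : option (J1 * J2 * nat) :=
  if unpickle n is Some k then
    if `[< A k `*` B k `<=` W >] then Some k else None
  else None.
exists (fun n => if code n is Some k then A k else set0).
exists (fun n => if code n is Some k then B k else set0).
split.
  move=> n; case: (code n) => [k|]; split; rewrite /A /B;
    [exact: open_interior|exact: open_interior|exact: open0|exact: open0].
apply/seteqP; split => [[x y] Wxy|w [n _]]; last first.
  rewrite /code; case: (unpickle n) => [k|]; last by case.
  by case: ifPn => [/asboolP|_]; [apply|case].
have /nbhs_ballP[e /= e0 xyeW] : nbhs (x, y) W by exact: open_nbhs_nbhs.
have [n ne] : exists n, n.+1%:R^-1 < e / 3.
  have e3 : 0 < e / 3 by lra.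
  have [n _ nP] := near_infty_natSinv_lt (PosNum e3).
  by exists n; exact: (nP n (leqnn n)).
pose r : R := n.+1%:R^-1; have r0 : 0 < r by rewrite invr_gt0.
have {}ne : r < e / 3 := ne.
have [i xi] := approx _ _ p1 x r dp1 r0.
have [j yj] := approx _ _ p2 y r dp2 r0.
have sub (T : pseudoMetricType R) (a b : T) : ball a r b ->
    (ball b (2 * r))° a /\ (ball b (2 * r))° `<=` ball a e.
  move=> ab; split.
    apply: filterS (nbhsx_ballx a r r0) => c ac.
    by rewrite mulr2n mulrDl mul1r; apply: ball_triangle ac; exact: ball_sym.
  move=> c /interior_subset bc.
  apply: (@le_ball _ _ _ (r + 2 * r)); first by lra.
  exact: ball_triangle ab bc.
have [xi1 xi2] := sub _ _ _ xi; have [yj1 yj2] := sub _ _ _ yj.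
exists (pickle ((i, j), n)) => //; rewrite /code pickleK.
case: ifPn => [_|/asboolPn[]] //.
by move=> [c d] [/= /xi2 xc /yj2 yd]; exact: xyeW.
Qed.

(** The direction vectors [(r_i, pi r_i)], with all the first coordinates placed
    before all the second ones. *)
Definition flow_dir (R : realType) d (r : 'rV[R]_d) : 'rV[R]_(d + d) :=
  row_mx r (pi *: r).

Definition torus_flow (R : realType) d (r : 'rV[R]_d) (x : torus R (d + d)) :
    torus R (d + d) :=
  torus_proj (torus_repr x + flow_dir r).

Lemma flow_dirD (R : realType) d (r s : 'rV[R]_d) :
  flow_dir (r + s) = flow_dir r + flow_dir s.
Proof. by rewrite /flow_dir scalerDr add_row_mx. Qed.

Lemma flow_dirB (R : realType) d (r s : 'rV[R]_d) :
  flow_dir (r - s) = flow_dir r - flow_dir s.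
Proof. by rewrite /flow_dir scalerBr opp_row_mx add_row_mx. Qed.

Lemma flow_dir0 (R : realType) d : flow_dir (0 : 'rV[R]_d) = 0.
Proof. by rewrite /flow_dir scaler0 row_mx0. Qed.

Lemma flow_dir_norm (R : realType) d (r : 'rV[R]_d) :
  `|flow_dir r| <= (1 + pi) * `|r|.
Proof.
have pi0 := pi_gt0 R.
apply/mx_norm_le => [|i j].
  by rewrite mulr_ge0// addr_ge0// ltW.
rewrite /flow_dir; case: (split_ordP j) => k ->; rewrite ?row_mxEl ?row_mxEr.
  by rewrite (le_trans (mx_norm_entry r i k))// ler_peMl// lerDl ltW.
rewrite mxE normrM (gtr0_norm pi0) ler_pM ?(ltW pi0) ?lerDr//.
exact: mx_norm_entry.
Qed.

Lemma torus_flow_proj (R : realType) d (r : 'rV[R]_d) (v : 'rV[R]_(d + d)) :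
  torus_flow r (torus_proj v) = torus_proj (v + flow_dir r).
Proof.
apply/torus_projP; rewrite opprD addrACA subrr addr0; exact: torus_reprK.
Qed.

Lemma torus_flow_action (R : realType) d : is_action (@torus_flow R d).
Proof.
split=> [x|r s x]; first by rewrite /torus_flow flow_dir0 addr0 torus_projK.
rewrite -[x in RHS]torus_projK !torus_flow_proj.
by rewrite -addrA [_ s + _]addrC -flow_dirD.
Qed.

Lemma torus_flow_continuous (R : realType) d :
  continuous (fun p : 'rV[R]_d * torus R (d + d) => torus_flow p.1 p.2).
Proof.
move=> [r x] A /nbhs_ballP[e /= e0 eA].
have c0 : 0 < 1 + pi :> R by rewrite addr_gt0// pi_gt0.
pose k : R := e / 2 / (1 + pi).
have k0 : 0 < k by rewrite !divr_gt0.
apply/nbhs_ballP; exists (Num.min k (e / 2)).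
  by rewrite /= lt_min k0 divr_gt0.
move=> [s y] [/= rs xy]; apply: eA.
rewrite torus_ball /= torus_dist_proj opprD addrACA.
apply: le_lt_trans (torus_normD _ _) _.
rewrite (splitr e) ltrD//.
  by move: xy; rewrite torus_ball /= lt_min => /andP[].
apply: le_lt_trans (torus_norm_le_norm _) _.
rewrite -flow_dirB; apply: le_lt_trans (flow_dir_norm _) _.
rewrite mulrC -ltr_pdivlMr//.
by move: rs; rewrite -ball_normE /= lt_min => /andP[].
Qed.

Lemma torus_flow_borel (R : realType) d :
  borel_action (X := borel (torus R (d + d))) (@torus_flow R d).
Proof.
split; first exact: torus_flow_action.
apply: (@measurability _ _ _ (borel (torus R (d + d))) _ _
  (@open (torus R (d + d)))) => //.
move=> _ [A oA <-]; rewrite setTI.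
have dq : dense (range (fun q : 'rV[rat]_(d + d) =>
    torus_proj (map_mx (@ratr R) q))).
  move=> O [x Ox] oO.
  have [||v [Ov [q _ qv]]] := @dense_rV_rat R _ (@torus_proj R _ @^-1` O).
  - by exists (torus_repr x); rewrite /= torus_projK.
  - by move/continuousP : (@torus_proj_continuous R (d + d)); apply.
  - by exists (torus_proj v); split => //; exists q; rewrite //= qv.
have oFA : open ((fun p : 'rV[R]_d * torus R (d + d) => torus_flow p.1 p.2)
    @^-1` A).
  by move/continuousP : (@torus_flow_continuous R d); apply.
have [B [C [oBC ->]]] := @open_bigcup_rect R 'rV[R]_d (torus R (d + d))
  'rV[rat]_d 'rV[rat]_(d + d) (fun q => map_mx ratr q) _ _
  (@dense_rV_rat R d) dq oFA.
apply: bigcupT_measurable => n; have [oB oC] := oBC n.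
by apply: measurableX; exact: sub_sigma_algebra.
Qed.

(** If the flow for time [r] fixes a point, then [r_i] and [pi r_i] are
    integers, and a nonzero [r_i] would make [pi] rational. *)
Lemma torus_flow_free (R : realType) d : free_action (@torus_flow R d).
Proof.
move=> r x; rewrite -[X in _ = X]torus_projK => /torus_projP.
rewrite addrC addKr => rint.
apply/rowP => i; rewrite mxE; apply/eqP/negP => ri0.
have := rint (lshift d i); rewrite row_mxEl intrEfloor => /eqP ri.
have := rint (rshift d i); rewrite row_mxEr mxE intrEfloor => /eqP pri.
apply: (@pi_irrationnal R).
exists ((Num.floor (pi * r ord0 i))%:~R / (Num.floor (r ord0 i))%:~R) => //.
rewrite fmorph_div/= !ratr_int ri pri mulfK//; exact/negP.
Qed.

(** * Uniform recurrence *)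

(** Dirichlet's approximation theorem, by the pigeonhole principle applied to
    the fractional parts of the first multiples. *)
Lemma dirichlet_approximation (R : realType) (alpha e : R) :
  irrational alpha -> 0 < e ->
  exists k p : int, 0 < `|k%:~R * alpha - p%:~R| < e.
Proof.
move=> airr e0.
have [M Me] : exists M, M.+1%:R^-1 < e.
  have [M _ MP] := near_infty_natSinv_lt (PosNum e0).
  by exists M; exact: (MP M (leqnn M)).
have M0 : 0 < M.+1%:R :> R by rewrite ltr0n.
pose x (k : nat) : R := frac_part (k%:R * alpha).
have x01 k : 0 <= x k < 1.
  have := floor_itv (k%:R * alpha); rewrite intrD /x /frac_part; lra.
have cell_lt (k : nat) : (Num.truncn (M.+1%:R * x k) < M.+1)%N.
  have /andP[x0 x1] := x01 k.
  by rewrite truncn_lt_nat ?mulr_ge0// -[ltRHS]mulr1 ltr_pM2l.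
have /injectivePn[i [j ij cij]] :
    ~~ injectiveb (fun k : 'I_M.+2 => Ordinal (cell_lt k)).
  by apply/negP => /injectiveP/leq_card; rewrite !card_ord ltnn.
exists (i%:Z - j%:Z), (Num.floor (i%:R * alpha) - Num.floor (j%:R * alpha)).
have -> : (i%:Z - j%:Z)%:~R * alpha -
    (Num.floor (i%:R * alpha) - Num.floor (j%:R * alpha))%:~R = x i - x j.
  by rewrite /x /frac_part !intrB; lra.
apply/andP; split.
  rewrite normr_gt0 subr_eq0; apply/eqP => xij; apply: airr.
  exists ((Num.floor (i%:R * alpha) - Num.floor (j%:R * alpha))%:~R /
    (i%:Z - j%:Z)%:~R) => //.
  rewrite fmorph_div/= !ratr_int; apply: (canLR (mulfK _)).
    by rewrite intr_eq0 subr_eq0 eqz_nat; apply: contra ij => /eqP/val_inj ->.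
  by move: xij; rewrite /x /frac_part !intrB; lra.
apply: lt_trans Me; rewrite -[ltRHS]mul1r ltr_pdivlMr//.
rewrite -[X in _ * X]gtr0_norm// -normrM mulrBl.
have tr k := truncn_itv (mulr_ge0 (ltW M0) (proj1 (andP (x01 k)))).
have := tr i; have := tr j; move/(congr1 val) : cij => /= ->.
rewrite -natr1 ltr_norml; lra.
Qed.

(** A multiple of [alpha] that is close to an integer but is not one moves in
    short steps, and a bounded number of them runs once around the circle. *)
Lemma kronecker_bounded (R : realType) (alpha e : R) :
  irrational alpha -> 0 < e ->
  exists K : R, forall y, exists k p : int,
    `|k%:~R| <= K :> R /\ `|y + k%:~R * alpha - p%:~R| < e.
Proof.
move=> airr e0.
have [k [p /andP[th0 the]]] : exists k p : int,
    0 < k%:~R * alpha - p%:~R < e.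
  have [k [p]] := dirichlet_approximation airr e0.
  have [th0|th0] := leP 0 (k%:~R * alpha - p%:~R).
    by rewrite ger0_norm// => ?; exists k, p.
  rewrite ltr0_norm// => ?; exists (- k), (- p).
  by rewrite !intrN mulNr -opprD.
set th := _ - _ in th0 the.
exists (`|k%:~R| / th) => y.
pose l := Num.floor y + 1.
have /andP[ly1 ly2] := floor_itv y; rewrite -/l in ly2.
have ly3 : l%:~R - y <= 1 by move: ly1; rewrite /l intrD; lra.
have ly0 : 0 <= (l%:~R - y) / th by rewrite divr_ge0 ?(ltW th0)// subr_ge0 ltW.
pose j := Num.truncn ((l%:~R - y) / th).
have /andP[j1 j2] := truncn_itv ly0; rewrite -/j in j1 j2.
rewrite ler_pdivlMr// in j1; rewrite ltr_pdivrMr// -natr1 mulrDl mul1r in j2.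
exists (j%:Z * k), (l + j%:Z * p); split.
  rewrite intrM normrM ler_pdivlMr// mulrC mulrA ger0_norm//.
  rewrite [leRHS](_ : _ = 1 * `|k%:~R|) ?mul1r// -{2}[`|_|]mul1r ler_wpM2r//.
  rewrite mulrC; exact: le_trans ly3.
rewrite intrD !intrM.
have -> : y + j%:~R * k%:~R * alpha - (l%:~R + j%:~R * p%:~R) =
  j%:R * th - (l%:~R - y) by rewrite /th; lra.
by rewrite ltr_norml; lra.
Qed.

Lemma torus_flow_recurrence (R : realType) d (u : 'rV[R]_(d + d)) (e : R) :
  0 < e -> exists K : R, forall v, exists (r : 'rV[R]_d) (z : 'rV[int]_(d + d)),
    `|r| <= K /\ ball u e (v + flow_dir r + map_mx intr z).
Proof.
move=> e0; have [K HK] := kronecker_bounded (@pi_irrationnal R) e0.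
have K0 : 0 <= K by have [k [_ [+ _]]] := HK 0; exact: le_trans.
exists (K + 1) => v.
(* The flow for time [frac_part (x - y)] brings the first circle of a factor
   to its target; integer times keep it there and rotate the second circle. *)
have /choice[t Ht] : forall i : 'I_d, exists t : R * int * int,
    `|t.1.1| <= K + 1 /\
    `|u ord0 (lshift d i) - (v ord0 (lshift d i) + t.1.1 + t.1.2%:~R)| < e /\
    `|u ord0 (rshift d i) - (v ord0 (rshift d i) + pi * t.1.1 + t.2%:~R)| < e.
  move=> i.
  set x := u ord0 (lshift d i); set y := v ord0 (lshift d i).
  pose s := frac_part (x - y).
  have s01 : 0 <= s < 1.
    have := floor_itv (x - y); rewrite intrD /s /frac_part; lra.
  have [k [p [kK kp]]] :=
    HK (v ord0 (rshift d i) + pi * s - u ord0 (rshift d i)).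
  exists (s + k%:~R, Num.floor (x - y) - k, - p) => /=; split; last split.
  - rewrite (le_trans (ler_normD _ _))// addrC lerD// ger0_norm; lra.
  - rewrite (_ : x - _ = 0) ?normr0// intrB /s /frac_part; lra.
  - rewrite distrC; apply: le_lt_trans kp.
    by rewrite intrN le_eqVlt; apply/orP; left; apply/eqP; congr `|_|; lra.
exists (\row_i (t i).1.1), (row_mx (\row_i (t i).1.2) (\row_i (t i).2)); split.
  apply/mx_norm_le => [|i j]; first by rewrite addr_ge0.
  by rewrite mxE; exact: (Ht j).1.
have entry (a b : 'rV[R]_(d + d)) (z : 'rV[int]_(d + d)) j :
    (a + b + map_mx intr z) ord0 j = a ord0 j + b ord0 j + (z ord0 j)%:~R.
  by rewrite !mxE.
split => // i j; rewrite (ord1 i) -ball_normE /= entry /flow_dir.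
by case: (split_ordP j) => k ->; rewrite ?row_mxEl ?row_mxEr !mxE;
  have [_ []] := Ht k.
Qed.

(** The entrance time is made rational by moving it slightly within the open
    set of times that lead into [U]; genericity can then be imposed for all
    times at once. *)
Lemma torus_flow_hits (R : realType) d (U : set 'rV[R]_(d + d)) :
  open U -> U !=set0 ->
  exists K : R, forall v, exists (q : 'rV[rat]_d) (z : 'rV[int]_(d + d)),
    `|map_mx (@ratr R) q| <= K /\
    U (v + flow_dir (map_mx (@ratr R) q) + map_mx intr z).
Proof.
move=> oU [u Uu].
have /nbhs_ballP[e /= e0 ueU] : nbhs u U by exact: open_nbhs_nbhs.
have [K HK] := torus_flow_recurrence u e0.
exists (K + 1) => v; have [r [z [rK /ueU Ur]]] := HK v.
pose F (s : 'rV[R]_d) : 'rV[R]_(d + d) := v + flow_dir s + map_mx intr z.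
have cF : continuous F.
  move=> s A /nbhs_ballP[k /= k0 kA].
  have c0 : 0 < 1 + pi :> R by rewrite addr_gt0// pi_gt0.
  apply/nbhs_ballP; exists (k / (1 + pi)); first by rewrite /= divr_gt0.
  move=> w; rewrite -ball_normE /= => sw; apply: kA; rewrite -ball_normE /=.
  rewrite /F opprD addrACA subrr addr0 opprD addrACA subrr add0r.
  rewrite -flow_dirB; apply: le_lt_trans (flow_dir_norm _) _.
  by rewrite mulrC -ltr_pdivlMr.
have [||s [[Us rs] [q _ qs]]] := @dense_rV_rat R d (F @^-1` U `&` ball r 1).
- by exists r; split => //; exact: ballxx.
- by apply: openI; [move/continuousP : cF; apply|exact: ball_open].
exists q, z; rewrite qs; split => //.
move: rs; rewrite -ball_normE /= => rs.
rewrite -[s](subrK r) (le_trans (ler_normD _ _))// addrC lerD//.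
by rewrite distrC ltW.
Qed.

(** * Growth of equivariant maps *)

(** The completeness and the norm of a space of matrices are joined here into
    the Banach space structure to which Baire's theorem applies. *)
HB.instance Definition _ (R : realType) m n := Complete.on 'M[R]_(m, n).

(** Uniform convergence on compact sets implies pointwise convergence, so that
    pointwise bounds are closed conditions on a map, however many there are. *)
Lemma eval_continuous (R : realType) d (V : uniformType) (r : 'rV[R]_d) :
  continuous (fun u : cts_space 'rV[R]_d V => u r).
Proof.
move=> u; have cu := @initial_continuous _ _ (fun w : continuousType _ V =>
  (w : 'rV[R]_d -> V) : {family compact, 'rV[R]_d -> V}) u.
have FF : Filter (nbhs (u : cts_space 'rV[R]_d V)) by exact: nbhs_filter.
have pu := pointwise_cvg_compact_family (fmap_filter _ FF) cu.
exact: (pointwise_cvgP _ (fmap_filter _ FF)).1 pu r.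
Qed.

Lemma euclidean_norm_bound (R : realType) d (K : R) (r : 'rV[R]_d) :
  `|r| <= K -> euclidean_norm r <= Num.sqrt (\sum_(i < d) K ^+ 2).
Proof.
move=> rK; rewrite ler_sqrt; last by apply: sumr_ge0 => i _; exact: sqr_ge0.
apply: ler_sum => i _; rewrite -real_normK ?num_real// lerXn2r ?nnegrE//.
  exact: le_trans rK.
exact: le_trans (mx_norm_entry _ _ _) rK.
Qed.

Lemma max_on_ball_ub (R : realType) d (Omega : normedModType R)
    (u : cts_space 'rV[R]_d Omega) (t : R) (r : 'rV[R]_d) :
  euclidean_norm r <= t -> `|u r| <= max_on_ball u t.
Proof.
move=> rt; apply: ub_le_sup; last by exists r.
pose I : set 'rV[R]_d := [set v | forall i, `[- t, t]%classic (v ord0 i)].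
have cI : compact I.
  exact: (@rV_compact R d (fun=> `[- t, t]%classic)
    (fun=> @segment_compact R _ _)).
have cuI : compact (u @` I).
  apply: continuous_compact cI; apply: continuous_subspaceT.
  exact: (@cts_fun _ _ (u : continuousType _ _)).
have [M [_ HM]] := compact_bounded cuI.
exists (M + 1) => _ [s st <-]; apply: (HM (M + 1)); first by rewrite ltrDl.
exists s => // i /=; rewrite in_itv /= -ler_norml.
apply: le_trans st; rewrite -sqrtr_sqr ler_sqrt.
  by rewrite (bigD1 i)//= lerDl sumr_ge0// => j _; exact: sqr_ge0.
by apply: sumr_ge0 => j _; exact: sqr_ge0.
Qed.

(** The same integer [N] is the threshold and the factor, and only integer radii
    are considered: so countably many sets of maps cover all cases. *)
Lemma limf_esup_bound (R : realType) d (Omega : normedModType R)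
    (u : cts_space 'rV[R]_d Omega) (f : R -> R) :
  f t @[t --> +oo] --> +oo ->
  limf_esup (fun t : R => (max_on_ball u t / f t)%:E) (pinfty_nbhs R)
    <> +oo%E ->
  exists N : nat, forall m : nat, (N < m)%N -> forall r,
    euclidean_norm r <= m%:R -> `|u r| <= N%:R * f m%:R.
Proof.
move=> foo; rewrite limf_esupE => Hinf.
have [A [A0 [c Ac]]] : exists A : set R, (\forall t \near +oo, A t) /\
    exists c : R, forall t, A t -> max_on_ball u t / f t <= c.
  apply: contrapT => HA; apply: Hinf; apply/ereal_inf_pinfty => _ [A A0 <-] /=.
  apply: contrapT => HS; apply: HA; exists A; split => //.
  exists (fine (ereal_sup [set (max_on_ball u t / f t)%:E | t in A])) => t At.
  have le : ((max_on_ball u t / f t)%:E <=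
      ereal_sup [set (max_on_ball u t / f t)%:E | t in A])%E.
    by apply: ereal_sup_ubound; exists t.
  move: le HS; case: (ereal_sup _) => //=.
have [t0 [_ Ht0]] := A0.
have [t1 [_ Ht1]] : \forall t \near +oo, 0 < f t by exact: cvgry_gt.
have nat_gt (a : R) : exists n : nat, a < n%:R.
  exists (Num.truncn `|a|).+1; apply: le_lt_trans (ler_norm a) _.
  by have /andP[] := truncn_itv (normr_ge0 a).
have [nc cnc] := nat_gt c; have [n0 tn0] := nat_gt t0.
have [n1 tn1] := nat_gt t1.
exists (nc + n0 + n1)%N => m Nm r rm.
have fm : 0 < f m%:R.
  by apply: Ht1; apply: lt_le_trans tn1 _; rewrite ler_nat; lia.
have Am : A m%:R.
  by apply: Ht0; apply: lt_le_trans tn0 _; rewrite ler_nat; lia.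
apply: le_trans (max_on_ball_ub u rm) _.
rewrite -ler_pdivrMr//; apply: le_trans (Ac _ Am) _; apply: ltW.
by apply: lt_le_trans cnc _; rewrite ler_nat; lia.
Qed.

(** Suppose that no point grows faster than [f]. The points with a given
    constant form countably many sets with the Baire property, so one of them
    is comeager in an open set [U]. Every point of a generic orbit reaches [U]
    within a bounded time, and from there the bound controls its own value; the
    whole orbit is then bounded. *)
Lemma torus_flow_fast_growth (R : realType) (Omega : completeNormedModType R) d
    (phi : borel (torus R (d + d)) -> cts_space 'rV[R]_d Omega) (f : R -> R) :
  borel_equivariant (X := borel (torus R (d + d))) (@torus_flow R d) phi ->
  everywhere_unbounded phi -> f t @[t --> +oo] --> +oo ->
  exists x, limf_esup (fun t : R => (max_on_ball (phi x) t / f t)%:E)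
    (pinfty_nbhs R) = +oo%E.
Proof.
move=> [mphi ephi] uphi foo; apply: contrapT => /forallNP slow.
pose Y (N : nat) : set (cts_space 'rV[R]_d Omega) :=
  [set u | forall m : nat, (N < m)%N -> forall r,
    euclidean_norm r <= m%:R -> `|u r| <= N%:R * f m%:R].
have closedY N : closed (Y N).
  have -> : Y N = \bigcap_(p in [set p : nat * 'rV[R]_d |
      (N < p.1)%N /\ euclidean_norm p.2 <= p.1%:R])
      (fun u : cts_space 'rV[R]_d Omega => u p.2) @^-1`
        [set y | `|y| <= N%:R * f p.1%:R].
    apply/seteqP; split=> u /= Yu => [[m r] [/= Nm rm]|m Nm r rm].
      exact: Yu.
    exact: (Yu (m, r)).
  apply: closed_bigI => -[m r] _; apply: preimage_closed.
    by move=> u _; exact: eval_continuous.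
  apply: (@preimage_closed _ _ (fun y : Omega => `|y|)
    [set y | y <= N%:R * f m%:R]).
    by move=> y _; exact: norm_continuous.
  exact: closed_le.
pose E (N : nat) : set 'rV[R]_(d + d) :=
  @torus_proj R (d + d) @^-1` (phi @^-1` Y N).
have bE N : baire_property (E N).
  apply: baire_property_preimage; first exact: torus_proj_continuous.
  have := mphi measurableT (Y N); rewrite setTI; apply.
  rewrite -[Y N]setCK; apply: measurableC; apply: sub_sigma_algebra.
  exact: (closed_openC (closedY N)).
have Ecover : \bigcup_N E N = setT.
  apply/seteqP; split => // v _.
  by have [N HN] := limf_esup_bound foo (slow (torus_proj v)); exists N.
have [N [U [oU U0 cU]]] := @baire_cover R 'rV[R]_(d + d) E bE Ecover.
have [K HK] := torus_flow_hits oU U0.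
have [v Hv] : exists v, forall (q : 'rV[rat]_d) (z : 'rV[int]_(d + d)),
    let w := v + flow_dir (map_mx (@ratr R) q) + map_mx intr z in U w -> E N w.
  have cT (p : 'rV[rat]_d * 'rV[int]_(d + d)) := comeager_translate
    (flow_dir (map_mx (@ratr R) p.1) + map_mx intr p.2) cU.
  have [v Hv] := @comeager_nonempty R 'rV[R]_(d + d) _
    (comeager_bigcap cT).
  by exists v => q z /=; have := Hv (q, z) I; rewrite /= addrA.
(* The ball of radius [m] must contain all the entrance times, which are bounded
   by [K] in the sup norm. *)
pose m := (N + Num.truncn (Num.sqrt (\sum_(i < d) K ^+ 2))).+1.
have Km : Num.sqrt (\sum_(i < d) K ^+ 2) <= m%:R.
  by apply: ltW; rewrite -truncn_lt_nat ?sqrtr_ge0// /m ltnS leq_addl.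
set u := phi (torus_proj v).
have bound_rat (s : 'rV[rat]_d) : `|u (map_mx ratr s)| <= N%:R * f m%:R.
  have [q [z [qK Uw]]] := HK (v + flow_dir (map_mx (@ratr R) s)).
  rewrite -(addrA v) -flow_dirD -map_mxD in Uw.
  have /(_ m _ (- map_mx ratr q)) := Hv _ _ Uw.
  have -> : torus_proj (v + flow_dir (map_mx ratr (s + q)) + map_mx intr z) =
      torus_flow (map_mx ratr (s + q)) (torus_proj v).
    rewrite torus_flow_proj; apply/torus_projP.
    by rewrite addrAC subrr add0r => i; rewrite mxE intr_int.
  have uE : shift_act (map_mx ratr (s + q)) u (- map_mx ratr q) =
      u (map_mx ratr s).
    rewrite -[LHS]/(u (- map_mx ratr q + map_mx ratr (s + q))).
    by rewrite map_mxD addrC addrK.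
  rewrite ephi uE; apply; first by rewrite /m ltnS leq_addr.
  by apply: le_trans Km; apply: euclidean_norm_bound; rewrite normrN.
have bound r : `|u r| <= N%:R * f m%:R.
  rewrite leNgt; apply/negP => ur.
  have ou : open [set r | N%:R * f m%:R < `|u r|].
    apply: (@open_comp _ _ (fun r => `|u r|) [set y | N%:R * f m%:R < y]).
      move=> s _; apply: continuous_comp; last exact: norm_continuous.
      exact: (@cts_fun _ _ (u : continuousType _ _)).
    exact: open_gt.
  have [s [us [q _ qs]]] := @dense_rV_rat R d _ (ex_intro _ r ur) ou.
  by move: us; rewrite /= -qs ltNge bound_rat.
have [t1 [_ Ht1]] : \forall t \near +oo, N%:R * f m%:R < max_on_ball u t.
  exact: cvgry_gt (uphi _) _.
pose t := Num.max t1 0 + 1.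
have t0 : 0 <= t by rewrite addr_ge0// le_max lexx orbT.
have : N%:R * f m%:R < max_on_ball u t.
  by apply: Ht1; rewrite /t ltr_pwDr// le_max lexx.
rewrite ltNge => /negP; apply; apply: ge_sup; last by move=> _ [r _ <-].
exists `|u 0|, 0 => //=; rewrite /euclidean_norm big1 ?sqrtr0// => i _.
by rewrite mxE expr0n.
Qed.

Theorem theoremA2 (R : realType) (Omega : completeNormedModType R)
    (hOmega : separable_space Omega) (d : nat) (hd : (1 <= d)%N) :
  exists (disp : measure_display) (X : measurableType disp)
         (act : 'rV[R]_d -> X -> X),
    [/\ standard_borel R X, borel_action act, free_action act &
        forall (phi : X -> cts_space 'rV[R]_d Omega) (f : R -> R),
          borel_equivariant act phi -> everywhere_unbounded phi ->
          rate_function f ->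
          exists x : X,
            limf_esup (fun t : R => (max_on_ball (phi x) t / f t)%:E)
              (pinfty_nbhs R) = +oo%E].
Proof.
exists _, (borel (torus R (d + d))), (@torus_flow R d); split.
- exact: standard_borel_torus.
- exact: torus_flow_borel.
- exact: torus_flow_free.
- move=> phi f ephi uphi [_ _ foo]; exact: torus_flow_fast_growth foo.
Qed.
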